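(* Let $G=(V,E)$ be a finite, connected, non-bipartite graph without multiple edges and self-loops, let $D$ be an integer such that $3\le D(x)\le D$ for all $x\in V$, where $D(x)$ is the degree of $x$, and let $c$ be a real number. If the spectrum of $\mathcal{S}^{*2}\mathcal{S}^2$ on $\ell^2_o(B,U)$ is contained in $[0,1-c]$, then the spectrum of $P^2$ on $\ell^2_o(V,\pi)$ is contained in $[0,1-D^{-2}c]$.
   Context: For vertices, $y\sim x$ means that $y$ is a neighbour of $x$. The measure $\pi$ on $V$ is $\pi(x)=D(x)$, and the operator $P$ on $\mathbb{C}^V$ is $Pf(x)=\frac{1}{D(x)}\sum_{y\sim x}f(y)$; it is self-adjoint on $\ell^2(V,\pi)$. $\ell^2_o(V,\pi)$ is the space of functions orthogonal to constants in $\ell^2(V,\pi)$; it is preserved by $P$. $B$ is the set of oriented edges of $G$ (each edge of $E$ gives two oriented edges), endowed with the uniform measure $U$ giving weight $1$ to each oriented edge. For $e\in B$, $o(e)$ is its origin and $t(e)$ its terminus. For $e,e'\in B$, $e'\leadsto e$ means that $t(e')=o(e)$ and $e$ is not the reverse of $e'$. The operator $\mathcal{S}$ on $\ell^2(B,U)$ is $\mathcal{S}f(e)=\frac{1}{D(o(e))-1}\sum_{e'\leadsto e}f(e')$, and $\mathcal{S}^*$ is its adjoint on $\ell^2(B,U)$. $\ell^2_o(B,U)$ is the space of functions orthogonal to constants in $\ell^2(B,U)$; it is preserved by $\mathcal{S}$ and $\mathcal{S}^*$. *)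

(* Defs.v *)
From HB Require Import structures.
From mathcomp Require Import all_boot all_order all_algebra.
From mathcomp Require Import reals.
From mathcomp Require Import complex.

Set Implicit Arguments.
Unset Strict Implicit.
Unset Printing Implicit Defensive.

Import Order.TTheory GRing.Theory Num.Theory.
Local Open Scope ring_scope.

(* A finite graph without multiple edges and self-loops is a symmetric,
   irreflexive relation [adj] on a finite type [V] of vertices. *)

Section Graph.
Variables (V : finType) (adj : rel V).

Definition connected_graph : Prop := forall x y : V, connect adj x y.

Definition bipartite : Prop :=
  exists A : {set V}, forall x y, adj x y -> (x \in A) != (y \in A).

Definition degree (x : V) : nat := #|[set y | adj x y]|.

(* The edge {x, y} gives the two oriented edges (x, y) and (y, x). *)
Definition oedge : Type := {p : V * V | adj p.1 p.2}.

Definition origin (e : oedge) : V := (val e).1.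
Definition terminus (e : oedge) : V := (val e).2.

(* [follows e' e] is e' ~> e: the edge e starts where e' ends, and e is not
   the reverse of e'. *)
Definition follows (e' e : oedge) : bool :=
  (terminus e' == origin e) && (val e != (terminus e', origin e')).

End Graph.

(* The space l^2(X, w) of a finite set X with weights w > 0 has underlying
   vector space C^X; [C^o] is C seen as a vector space over itself. *)
Section L2.
Variables (C : numClosedFieldType) (X : finType) (w : X -> C).

Definition inner (f g : {ffun X -> C^o}) : C := \sum_x w x * f x * (g x)^*.

Definition inner_one (f : {ffun X -> C^o}) : C^o := inner f [ffun=> 1].

Fact inner_one_is_linear : linear inner_one.
Proof.
move=> a f g; rewrite /inner_one /inner scaler_sumr -big_split /=.
apply: eq_bigr => x _; rewrite !ffunE mulrDr mulrDl; congr (_ + _).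
by rewrite /GRing.scale /= !mulrA [w x * a]mulrC.
Qed.
HB.instance Definition _ :=
  GRing.isLinear.Build C {ffun X -> C^o} C^o _ inner_one inner_one_is_linear.

Definition l2o : {vspace {ffun X -> C^o}} := lker (linfun inner_one).

Lemma mem_l2o f : (f \in l2o) = (inner f [ffun=> 1] == 0).
Proof. by rewrite memv_ker lfunE. Qed.

Definition indic (x : X) : {ffun X -> C^o} := [ffun y => (y == x)%:R].

(* The adjoint of T on l^2(X, w), obtained by testing on indicators:
   w(x) (T^* g)(x) = <T^* g, 1_x> = <g, T 1_x>; see [adjointP]. *)
Definition adjoint_fun (T : 'End({ffun X -> C^o})) (g : {ffun X -> C^o}) :
  {ffun X -> C^o} := [ffun x => (w x)^-1 * inner g (T (indic x))].

Fact adjoint_fun_is_linear T : linear (adjoint_fun T).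
Proof.
move=> a f g; apply/ffunP => x; rewrite !ffunE /inner.
rewrite /GRing.scale /= mulrCA -mulrDr; congr (_ * _).
rewrite mulr_sumr -big_split /=.
apply: eq_bigr => y _; rewrite !ffunE mulrDr mulrDl; congr (_ + _).
by rewrite /GRing.scale /= !mulrA [w y * a]mulrC.
Qed.
HB.instance Definition _ T :=
  GRing.isLinear.Build C {ffun X -> C^o} {ffun X -> C^o} _ (adjoint_fun T)
    (adjoint_fun_is_linear T).

Definition adjoint (T : 'End({ffun X -> C^o})) : 'End({ffun X -> C^o}) :=
  linfun (adjoint_fun T).

Lemma adjointP (T : 'End({ffun X -> C^o})) f g :
  (forall x, 0 < w x) -> inner (T f) g = inner f (adjoint T g).
Proof.
move=> w_gt0; pose h := adjoint T g.
have Tf y : T f y = \sum_x f x * T (indic x) y.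
  have {1}-> : f = \sum_x f x *: indic x.
    apply/ffunP => z; rewrite sum_ffunE (bigD1 z) //= big1 => [|x /negPf nx].
      by rewrite addr0 !ffunE eqxx /GRing.scale /= mulr1.
    by rewrite !ffunE eq_sym nx /GRing.scale /= mulr0.
  rewrite linear_sum sum_ffunE; apply: eq_bigr => x _.
  by rewrite linearZ ffunE.
rewrite /inner; under eq_bigr do rewrite Tf mulr_sumr mulr_suml.
rewrite exchange_big /=; apply: eq_bigr => x _.
rewrite lfunE /= ffunE rmorphM /= fmorphV /= (CrealP (gtr0_real (w_gt0 x))).
rewrite [w x * f x]mulrC -mulrA mulVKf ?gt_eqF // /inner rmorph_sum mulr_sumr.
apply: eq_bigr => y _; rewrite !rmorphM /= conjCK.
rewrite (CrealP (gtr0_real (w_gt0 y))) !mulrA [w y * f x]mulrC.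
by rewrite -!mulrA; congr (_ * (_ * _)); rewrite mulrC.
Qed.

End L2.

(* The spectrum on W of an operator T preserving W: all l such that T - l is
   not an invertible map from W to W. *)
Definition spectrum_on (K : fieldType) (vT : vectType K)
    (T : 'End(vT)) (W : {vspace vT}) (l : K) : Prop :=
  let Tl := (T - l *: \1)%VF in
  ~ ((lker Tl :&: W)%VS = 0%VS /\ (Tl @: W)%VS = W).

Section Operators.
Variables (C : numClosedFieldType) (V : finType) (adj : rel V).
Notation B := (oedge adj).

Definition vmeasure (x : V) : C := (degree adj x)%:R.
Definition emeasure (e : B) : C := 1.

Definition markov_fun (f : {ffun V -> C^o}) : {ffun V -> C^o} :=
  [ffun x => (degree adj x)%:R^-1 * \sum_(y | adj x y) f y].

Fact markov_fun_is_linear : linear markov_fun.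
Proof.
move=> a f g; apply/ffunP => x; rewrite !ffunE.
rewrite /GRing.scale /= mulrCA -mulrDr; congr (_ * _).
rewrite mulr_sumr -big_split /=.
by apply: eq_bigr => y _; rewrite !ffunE.
Qed.
HB.instance Definition _ :=
  GRing.isLinear.Build C {ffun V -> C^o} {ffun V -> C^o} _ markov_fun
    markov_fun_is_linear.

Definition markovP : 'End({ffun V -> C^o}) := linfun markov_fun.

Lemma markovPE f x :
  markovP f x = (degree adj x)%:R^-1 * \sum_(y | adj x y) f y.
Proof. by rewrite lfunE /= ffunE. Qed.

Definition nbS_fun (f : {ffun B -> C^o}) : {ffun B -> C^o} :=
  [ffun e => ((degree adj (origin e))%:R - 1)^-1
             * \sum_(e' | follows e' e) f e'].

Fact nbS_fun_is_linear : linear nbS_fun.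
Proof.
move=> a f g; apply/ffunP => x; rewrite !ffunE.
rewrite /GRing.scale /= mulrCA -mulrDr; congr (_ * _).
rewrite mulr_sumr -big_split /=.
by apply: eq_bigr => y _; rewrite !ffunE.
Qed.
HB.instance Definition _ :=
  GRing.isLinear.Build C {ffun B -> C^o} {ffun B -> C^o} _ nbS_fun
    nbS_fun_is_linear.

Definition nbS : 'End({ffun B -> C^o}) := linfun nbS_fun.

Lemma nbSE f e :
  nbS f e = ((degree adj (origin e))%:R - 1)^-1
            * \sum_(e' | follows e' e) f e'.
Proof. by rewrite lfunE /= ffunE. Qed.

Definition nbS_adj : 'End({ffun B -> C^o}) := adjoint emeasure nbS.

End Operators.

Arguments vmeasure C {V} adj.
Arguments emeasure C {V} adj.
Arguments markovP C {V} adj.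
Arguments nbS C {V} adj.
Arguments nbS_adj C {V} adj.

(* Main.v *)
Require Import Defs.
From mathcomp Require Import all_boot all_order all_algebra.
From mathcomp Require Import reals.
From mathcomp Require Import complex.
Import Order.TTheory GRing.Theory Num.Theory.
Local Open Scope ring_scope.

(* Let P^2 f = l f with f orthogonal to constants, and put F(e) = f(t(e)), which
   has the same norm as f. Then S F(e) = f(o(e)), and the mean of S^2 F over
   the edges starting at x is P f(x), so that by convexity
     |S^2 F|^2 >= |P f|^2 = l |f|^2 = l |F|^2.
   Hence l is at most the largest eigenvalue of S*^2 S^2 on the orthogonal of
   the constants: l <= 1 - c, which improves on the claim if c >= 0. If c < 0,
   the claim follows from l <= 1. *)

(** * Hermitian forms bounded by eigenvalues *)

Section HermitianForm.
Context {C : numClosedFieldType} {n : nat}.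
Implicit Types (A : 'M[C]_n) (u v e : 'rV[C]_n).
Local Open Scope sesquilinear_scope.

Lemma trmxC_mul m p q (A : 'M[C]_(m, p)) (B : 'M_(p, q)) :
  (A *m B)^t* = B^t* *m A^t*.
Proof. by rewrite trmx_mul map_mxM. Qed.

Lemma row_dot_ge0 u : 0 <= (u *m u^t*) 0 0.
Proof. by rewrite mxE sumr_ge0 // => i _; rewrite !mxE mul_conjC_ge0. Qed.

Lemma row_dot_eq0 u : ((u *m u^t*) 0 0 == 0) = (u == 0).
Proof.
rewrite mxE psumr_eq0 => [|i _]; last by rewrite !mxE mul_conjC_ge0.
apply/allP/eqP => [u0|-> i _]; last by rewrite !mxE mul0r eqxx implybT.
apply/rowP => i; have /= := u0 i.
rewrite mem_index_enum !mxE mul_conjC_eq0.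
by move=> /(_ isT)/eqP.
Qed.

(** Diagonalise A by a unitary P. The diagonal entries are eigenvalues with the rows of P as
    eigenvectors, hence at most b, and in the coordinates [u *m P^t*] the form is a sum of squared
    moduli weighted by these entries. *)
Lemma hermitian_form_le A b :
    A^t* = A -> (forall l v, v != 0 -> v *m A = l *: v -> l <= b) ->
  forall u, (u *m A *m u^t*) 0 0 <= b * (u *m u^t*) 0 0.
Proof.
move=> hermA leb u.
have /orthomx_spectralP : A \is normalmx by rewrite qualifE /= hermA.
set P := spectralmx A; set d := spectral_diag A => defA.
have unitP : P \is unitarymx by exact: spectral_unitarymx.
have PA : P *m A = diag_mx d *m P.
  by rewrite {1}defA !mulmxA mulmxV ?mul1mx ?unitarymx_unit.
have d_le i : d 0 i <= b.
  apply: (leb _ (row i P)); last first.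
    by rewrite -row_mul PA row_mul row_diag_mx -scalemxAl -rowE.
  (* A zero row would put a 0 on the diagonal of [P *m P^t*], which is the identity. *)
  apply/eqP => Pi0; have /unitarymxP/(congr1 (row i)) := unitP.
  rewrite row_mul Pi0 mul0mx => /rowP/(_ i)/eqP.
  by rewrite !mxE eqxx eq_sym oner_eq0.
pose v := u *m P^t*.
have -> : u *m u^t* = v *m v^t*.
  by rewrite trmxC_mul trmxCK mulmxA mulmxKtV.
have -> : u *m A *m u^t* = v *m diag_mx d *m v^t*.
  by rewrite trmxC_mul trmxCK defA invmx_unitary // !mulmxA.
rewrite !mxE mulr_sumr ler_sum // => i _; rewrite mul_mx_diag !mxE.
by rewrite mulrAC mulrC ler_wpM2r ?mul_conjC_ge0.
Qed.

(* Adding a multiple of e^t* e to A moves the eigenvalue of e to b without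
   affecting A on the orthogonal complement of e. *)
Lemma hermitian_form_le_orth A e a b :
    A^t* = A -> e *m A = a *: e -> a \is Num.real -> b \is Num.real ->
    (forall l v, v != 0 -> v *m e^t* = 0 -> v *m A = l *: v -> l <= b) ->
  forall u, u *m e^t* = 0 -> (u *m A *m u^t*) 0 0 <= b * (u *m u^t*) 0 0.
Proof.
move=> hermA eA ra rb leb u ue.
(* This [k] makes [a + k * N] equal to b when e is nonzero. If e is zero, then [N] and [k] are zero
   too, and [A'] is A. *)
pose N := (e *m e^t*) 0 0; pose k : C := (b - a) / N.
pose A' := A + k *: (e^t* *m e).
have rk : k^* = k.
  by apply/CrealP; rewrite rpredM ?rpredB ?rpredV /=;
    last exact: ger0_real (row_dot_ge0 e).
have hermA' : A'^t* = A'.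
  rewrite /A' linearD /= map_mxD hermA linearZ /= map_mxZ [_ k]rk.
  by rewrite trmxC_mul trmxCK.
have -> : u *m A = u *m A'.
  by rewrite mulmxDr -scalemxAr mulmxA ue mul0mx scaler0 addr0.
apply: (hermitian_form_le _ _ hermA') => l v v0 vA'.
have [ve|ve] := eqVneq (v *m e^t*) 0.
  apply: (leb _ _ v0 ve); rewrite -vA' mulmxDr -scalemxAr mulmxA ve.
  by rewrite mul0mx scaler0 addr0.
have N0 : N != 0.
  rewrite row_dot_eq0; apply: contraNneq ve => ->.
  by rewrite trmx0 map_mx0 mulmx0.
suff -> : l = b by [].
(* As A is Hermitian and a is real, [e^t*] is a right eigenvector of A, and [A'] multiplies it by b.
   Pairing [v *m A' = l *: v] with it gives l = b, since [v *m e^t*] is nonzero. *)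
have AE : A *m e^t* = a *: e^t*.
  by rewrite -{1}hermA -trmxC_mul eA linearZ /= map_mxZ [_ a](CrealP ra).
have eE : e *m e^t* = N%:M by exact: mx11_scalar.
have : v *m A' *m e^t* = l *: v *m e^t* by rewrite vA'.
rewrite mulmxDr mulmxDl -mulmxA AE -!scalemxAr -!scalemxAl !mulmxA.
rewrite -[v *m _ *m _ *m _]mulmxA eE mul_mx_scalar scalerA /k mulfVK //.
rewrite -scalerDl addrC subrK => /eqP; rewrite -subr_eq0 -scalerBl.
by rewrite scaler_eq0 (negPf ve) orbF subr_eq0 => /eqP.
Qed.

End HermitianForm.

(** * Weighted inner products, adjoints, and their matrices *)

Section L2Theory.
Context {C : numClosedFieldType} {X : finType}.
Implicit Types (w : X -> C) (f g : {ffun X -> C^o}).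

Lemma ffun_sum_indic f : f = \sum_x f x *: indic C x.
Proof.
apply/ffunP => y; rewrite sum_ffunE (bigD1 y) //= big1 => [|x /negPf nx].
  by rewrite addr0 !ffunE eqxx /GRing.scale /= mulr1.
by rewrite !ffunE eq_sym nx /GRing.scale /= mulr0.
Qed.

Lemma inner_conj w f g :
  (forall x, 0 < w x) -> (inner w f g)^* = inner w g f.
Proof.
move=> w_gt0; rewrite /inner rmorph_sum; apply: eq_bigr => x _.
by rewrite !rmorphM /= conjCK (CrealP (gtr0_real (w_gt0 x))) mulrAC.
Qed.

Lemma innerZl w a f g : inner w (a *: f) g = a * inner w f g.
Proof.
rewrite /inner mulr_sumr; apply: eq_bigr => x _.
by rewrite ffunE !mulrA [a * _]mulrC.
Qed.

Lemma inner_normE w f : inner w f f = \sum_x w x * `|f x| ^+ 2.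
Proof. by apply: eq_bigr => x _; rewrite -mulrA -normCK. Qed.

Lemma inner_ge0 w f : (forall x, 0 < w x) -> 0 <= inner w f f.
Proof.
move=> w_gt0; rewrite inner_normE sumr_ge0 // => x _.
by rewrite mulr_ge0 ?exprn_ge0 // ltW.
Qed.

Lemma inner_gt0 w f : (forall x, 0 < w x) -> f != 0 -> 0 < inner w f f.
Proof.
move=> w_gt0 f0; rewrite lt0r inner_ge0 // andbT inner_normE.
rewrite psumr_eq0 => [|x _]; last by rewrite mulr_ge0 ?exprn_ge0 // ltW.
apply: contraNN f0 => /allP fx0; apply/eqP/ffunP => x; rewrite ffunE.
have /= := fx0 x; rewrite mem_index_enum mulf_eq0 gt_eqF // expf_eq0 normr_eq0.
by move=> /(_ isT)/eqP.
Qed.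

Lemma adjointPr w (T : 'End({ffun X -> C^o})) f g :
  (forall x, 0 < w x) -> inner w (adjoint w T f) g = inner w f (T g).
Proof. by move=> w_gt0; rewrite -inner_conj // -adjointP // inner_conj. Qed.

(** Coordinates in the basis of indicators, to which the matrix bounds apply: operators act by right
    multiplication, and for weight 1 [inner] is the standard Hermitian product. *)
Let row_of f : 'rV[C]_#|X| := \row_i f (enum_val i).
Let ffun_of (u : 'rV[C]_#|X|) : {ffun X -> C^o} := [ffun x => u 0 (enum_rank x)].
Let mx_of (T : 'End({ffun X -> C^o})) : 'M[C]_#|X| :=
  \matrix_(i, j) T (indic C (enum_val i)) (enum_val j).

Local Open Scope sesquilinear_scope.

Let ffun_ofK u : row_of (ffun_of u) = u.
Proof. by apply/rowP => i; rewrite mxE ffunE enum_valK. Qed.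

Let row_ofZ a f : row_of (a *: f) = a *: row_of f.
Proof. by apply/rowP => i; rewrite !mxE ffunE. Qed.

Let row_of_inj f g : row_of f = row_of g -> f = g.
Proof.
move=> /rowP fg; apply/ffunP => x.
by have := fg (enum_rank x); rewrite !mxE enum_rankK.
Qed.

Let sum_enum (F : X -> C) :
  \sum_x F x = \sum_(i < #|X|) F (enum_val i).
Proof. exact/reindex/onW_bij/enum_val_bij. Qed.

Let inner_row f g :
  inner (fun=> 1) f g = (row_of f *m (row_of g)^t*) 0 0.
Proof.
rewrite mxE /inner sum_enum.
by apply: eq_bigr => i _; rewrite !mxE mul1r.
Qed.

Let row_ofM (T : 'End({ffun X -> C^o})) f : row_of (T f) = row_of f *m mx_of T.
Proof.
apply/rowP => j; rewrite !mxE {1}[f]ffun_sum_indic linear_sum sum_ffunE sum_enum.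
by apply: eq_bigr => i _; rewrite linearZ ffunE !mxE.
Qed.

(** This is [hermitian_form_le_orth] in coordinates, with the constant function 1 as the eigenvector
    e that is split off. *)
Lemma l2o_form_le (T : 'End({ffun X -> C^o})) a b :
    (forall f g, inner (fun=> 1) (T f) g = inner (fun=> 1) f (T g)) ->
    T [ffun=> 1] = a *: [ffun=> 1] -> a \is Num.real -> b \is Num.real ->
    (forall l f, f \in l2o (fun=> 1) -> f != 0 -> T f = l *: f -> l <= b) ->
  forall f, f \in l2o (fun=> 1) ->
    inner (fun=> 1) (T f) f <= b * inner (fun=> 1) f f.
Proof.
move=> symT T1 ra rb leb f; rewrite mem_l2o => /eqP f1.
have orth g : (row_of g *m (row_of [ffun=> 1])^t* == 0)
            = (inner (fun=> 1) g [ffun=> 1] == 0).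
  rewrite inner_row; apply/eqP/eqP => [->|g1]; first by rewrite mxE.
  by rewrite [LHS]mx11_scalar g1 raddf0.
rewrite !inner_row row_ofM.
apply: (@hermitian_form_le_orth _ _ (mx_of T) (row_of [ffun=> 1]) a b) => //.
- apply/matrixP => i j; rewrite !mxE.
  (* Symmetry of T tested on two indicators compares the entries of the matrix and of its conjugate
     transpose. *)
  have := symT (indic C (enum_val i)) (indic C (enum_val j)).
  rewrite /inner (bigD1 (enum_val j)) //= big1 => [|x /negPf nx]; last first.
    by rewrite [indic _ _ x]ffunE nx conjC0 mulr0.
  rewrite (bigD1 (enum_val i)) //= big1 => [|x /negPf nx]; last first.
    by rewrite [indic _ _ x]ffunE nx mulr0 mul0r.
  by rewrite [indic _ _ (enum_val j)]ffunE [indic _ _ (enum_val i)]ffunE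
     !eqxx conjC1 !mul1r !addr0 mulr1 => ->.
- by rewrite -row_ofM T1 row_ofZ.
- move=> l v v0 /eqP; rewrite -[v in v *m _]ffun_ofK orth => v1 vT.
  apply: (leb l (ffun_of v)); first by rewrite mem_l2o.
    apply: contraNneq v0 => v0; rewrite -[v]ffun_ofK v0.
    by apply/eqP/rowP => i; rewrite !mxE ffunE.
  by apply: row_of_inj; rewrite row_ofM row_ofZ ffun_ofK.
- by apply/eqP; rewrite orth f1.
Qed.

End L2Theory.

(** * Spectrum on an invariant subspace and eigenvectors *)

Section Spectrum.
Context {K : fieldType} {vT : vectType K}.
Implicit Types (T : 'End(vT)) (W : {vspace vT}).

Let shiftE T l v : (T - l *: \1)%VF v = T v - l *: v.
Proof. by rewrite add_lfunE opp_lfunE scale_lfunE id_lfunE. Qed.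

Lemma eigenvector_spectrum_on T W l v :
  v \in W -> v != 0 -> T v = l *: v -> spectrum_on T W l.
Proof.
move=> vW v0 Tv; rewrite /spectrum_on => -[kerW _].
case/eqP: v0; apply/eqP; rewrite -memv0 -kerW.
by rewrite memv_cap vW memv_ker shiftE Tv subrr eqxx.
Qed.

(** In finite dimension, if T - l is injective on the invariant subspace W, then its image lies in W
    and has the same dimension, so T - l is invertible on W. *)
Lemma spectrum_on_eigenvector T W l :
    {in W, forall v, T v \in W} -> spectrum_on T W l ->
  exists v, [/\ v \in W, v != 0 & T v = l *: v].
Proof.
move=> TW; rewrite /spectrum_on; set Tl := (T - l *: \1)%VF => sl.
have [ker0|ker_n0] := eqVneq (W :&: lker Tl)%VS 0%VS.
  case: sl; split; first by rewrite capvC.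
  apply/eqP; rewrite eqEdim limg_dim_eq // leqnn andbT.
  apply/subvP => _ /memv_imgP[v vW ->].
  by rewrite shiftE memvB ?TW // memvZ.
exists (vpick (W :&: lker Tl)%VS).
have := memv_pick (W :&: lker Tl)%VS; rewrite memv_cap memv_ker shiftE subr_eq0.
by move=> /andP[-> /eqP->]; rewrite vpick0.
Qed.

End Spectrum.

(** * Sums over neighbours and oriented edges *)

Section Graph.
Context {C : numClosedFieldType} {V : finType} {adj : rel V}.
Hypotheses (adj_sym : symmetric adj) (deg_ge2 : forall x, (2 <= degree adj x)%N).
Local Notation B := (oedge adj).
Local Notation S := (nbS C adj).
Local Notation S' := (nbS_adj C adj).
Local Notation P := (markovP C adj).
Local Notation deg x := ((degree adj x)%:R : C).

Let deg_gt0 x : 0 < deg x.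
Proof. by rewrite ltr0n (leq_trans _ (deg_ge2 x)). Qed.

Let deg1_gt0 x : 0 < deg x - 1.
Proof. by rewrite subr_gt0 ltr1n. Qed.

Lemma sum_oedge (F : V * V -> C) :
  \sum_(e : B) F (val e) = \sum_x \sum_(y | adj x y) F (x, y).
Proof.
rewrite (pair_big_dep xpredT adj (fun x y => F (x, y))) /=.
rewrite -(big_sub (fun p : V * V => adj p.1 p.2) F).
by apply: eq_bigr => -[].
Qed.

Lemma sum_adj_swap (F : V -> V -> C) :
  \sum_x \sum_(y | adj x y) F x y = \sum_y \sum_(x | adj y x) F x y.
Proof.
rewrite (exchange_big_dep xpredT) //=; apply: eq_bigr => y _.
by apply: eq_bigl => x; rewrite adj_sym.
Qed.

Lemma sum_adj_const x (a : C) : \sum_(y | adj x y) a = deg x * a.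
Proof. by rewrite sumr_const mulr_natl /degree cardsE. Qed.

Lemma sum_adj_except x z (F : V -> C) : adj x z ->
  \sum_(y | adj x y && (y != z)) F y = \sum_(y | adj x y) F y - F z.
Proof. by move=> xz; rewrite [in RHS](bigD1 z) //= [RHS]addrC addKr. Qed.

Lemma sum_oedge_cond (Q : pred (V * V)) (F : V * V -> C) :
  \sum_(e : B | Q (val e)) F (val e)
    = \sum_x \sum_(y | adj x y && Q (x, y)) F (x, y).
Proof.
rewrite big_mkcond (sum_oedge (fun p => if Q p then F p else 0)).
by apply: eq_bigr => x _; rewrite -big_mkcondr.
Qed.

(** The edges preceding e = (x, z) are the (y, x) with y a neighbour of x other than z; the
    subtracted term is that of the reverse of e. Taking [F] on all pairs keeps adjacency proofs out
    of the sums. *)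
Lemma sum_follows_to (F : V * V -> C) (e : B) :
  \sum_(e' | follows e' e) F (val e')
    = \sum_(y | adj (origin e) y) F (y, origin e) - F (terminus e, origin e).
Proof.
case: e => -[x z] xz; rewrite /origin /terminus /=.
rewrite (sum_oedge_cond
  (fun p => (p.2 == x) && ((x, z) != (p.2, p.1))) F) /=.
rewrite -(sum_adj_except _ _ (fun y => F (y, x)) xz) [RHS]big_mkcond /=.
apply: eq_bigr => y _; rewrite big_mkcond (bigD1 x) //= big1 => [|t /negPf tx].
  by rewrite eqxx xpair_eqE eqxx adj_sym addr0 [y == z]eq_sym.
by rewrite tx /= andbF.
Qed.

Lemma sum_follows_from (F : V * V -> C) (e : B) :
  \sum_(e' | follows e e') F (val e')
    = \sum_(y | adj (terminus e) y) F (terminus e, y)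
      - F (terminus e, origin e).
Proof.
case: e => -[z x] zx; rewrite /origin /terminus /=.
rewrite (sum_oedge_cond (fun p => (x == p.1) && (p != (x, z))) F) /=.
rewrite -(sum_adj_except _ _ (fun y => F (x, y))) 1?adj_sym //.
rewrite (bigD1 x) //= [X in _ + X]big1 => [|t /negPf tx].
  by rewrite addr0; apply: eq_bigl => y; rewrite xpair_eqE eqxx.
by rewrite big1 // => y; rewrite eq_sym tx andbF.
Qed.

(** * Self-adjointness of P, and invariance of constants *)

(** The weight cancels the factor 1 / deg x, leaving the sum of f(y) times the conjugate of g(x)
    over oriented edges (x, y); reversing the edges exchanges the roles of f and g. *)
Lemma markov_symmetric f g :
  inner (vmeasure C adj) (P f) g = inner (vmeasure C adj) f (P g).
Proof.
rewrite /inner.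
transitivity (\sum_x \sum_(y | adj x y) (f y : C) * (g x)^*).
  apply: eq_bigr => x _; rewrite markovPE mulVKf ?gt_eqF ?deg_gt0 //.
  by rewrite -mulr_suml.
rewrite sum_adj_swap; apply: eq_bigr => x _; rewrite markovPE rmorphM /=.
rewrite fmorphV /= conjC_nat [_ * f x]mulrC -mulrA mulVKf ?gt_eqF ?deg_gt0 //.
by rewrite rmorph_sum mulr_sumr.
Qed.

Lemma markov1 : P [ffun=> 1] = [ffun=> 1].
Proof.
apply/ffunP => x; rewrite markovPE ffunE.
under eq_bigr do rewrite ffunE.
by rewrite sum_adj_const mulr1 mulVf ?gt_eqF.
Qed.

Lemma markov_l2o f :
  f \in l2o (vmeasure C adj) -> P f \in l2o (vmeasure C adj).
Proof. by rewrite !mem_l2o markov_symmetric markov1. Qed.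

Lemma nbS1 : S [ffun=> 1] = [ffun=> 1].
Proof.
apply/ffunP => e; rewrite nbSE ffunE; under eq_bigr do rewrite ffunE.
rewrite (sum_follows_to (fun=> 1)) sum_adj_const mulr1.
by rewrite mulVf ?gt_eqF.
Qed.

(** The value at e is the sum of 1 / (deg(o(e')) - 1) over the edges e' following e. All of these
    start at t(e), and there are deg(t(e)) - 1 of them. *)
Lemma nbS_adj1 : S' [ffun=> 1] = [ffun=> 1].
Proof.
apply/ffunP => e; rewrite lfunE /= !ffunE /emeasure invr1 mul1r /inner.
transitivity (\sum_(e' : B | follows e e') (deg (val e').1 - 1)^-1).
  rewrite [RHS]big_mkcond; apply: eq_bigr => e' _.
  rewrite ffunE !mul1r nbSE rmorphM /= fmorphV /= rmorphB /= conjC1 conjC_nat.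
  under eq_bigr do rewrite ffunE.
  (* The image under S of the indicator of e is supported on the edges following e. *)
  rewrite -/(origin _); have [fe|nfe] := boolP (follows e e').
    rewrite (bigD1 e) //= big1 => [|i /andP[_ /negPf->]] //.
    by rewrite eqxx addr0 conjC1 mulr1.
  rewrite big1 ?conjC0 ?mulr0 // => i fi.
  by case: eqVneq => // ie; move: nfe; rewrite -ie fi.
rewrite (sum_follows_from (fun p => (deg p.1 - 1)^-1)) /= sum_adj_const.
by rewrite -[X in _ - X]mul1r -mulrBl mulfV ?gt_eqF.
Qed.

(** * Convexity and the contraction property of P *)

(** The difference of the two sides is the sum of the squared deviations from the mean m. *)
Lemma normr_mean_le (I : finType) (A : pred I) (g : I -> C) m :
  \sum_(i | A i) g i = #|A|%:R * m ->
  #|A|%:R * `|m| ^+ 2 <= \sum_(i | A i) `|g i| ^+ 2.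
Proof.
move=> gm; rewrite -subr_ge0.
suff <- : \sum_(i | A i) `|g i - m| ^+ 2
        = \sum_(i | A i) `|g i| ^+ 2 - #|A|%:R * `|m| ^+ 2.
  by apply: sumr_ge0 => i _; rewrite exprn_ge0.
under eq_bigr => i _ do rewrite normCK rmorphB /= mulrBl !mulrBr -normCK.
rewrite !sumrB -mulr_suml gm -mulr_sumr -rmorph_sum gm rmorphM /= conjC_nat.
rewrite sumr_const -[m * _ *+ _]mulr_natl.
by rewrite [m * (_ * _)]mulrCA subrr subr0 normCK mulrA.
Qed.

Lemma normr_neighbour_mean_le x (g : V -> C) m :
  \sum_(y | adj x y) g y = deg x * m ->
  deg x * `|m| ^+ 2 <= \sum_(y | adj x y) `|g y| ^+ 2.
Proof. by rewrite /degree cardsE; exact: normr_mean_le. Qed.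

(** Convexity is applied at each vertex x to the values of f at its neighbours; summed over x, each
    vertex y is counted deg y times, which is its mass. *)
Lemma markov_contraction f :
  inner (vmeasure C adj) (P f) (P f) <= inner (vmeasure C adj) f f.
Proof.
rewrite !inner_normE.
have -> : \sum_x vmeasure C adj x * `|f x| ^+ 2
        = \sum_x \sum_(y | adj x y) `|f y| ^+ 2.
  rewrite sum_adj_swap; apply: eq_bigr => x _.
  by rewrite sum_adj_const.
apply: ler_sum => x _; apply: normr_neighbour_mean_le.
by rewrite markovPE mulVKf ?gt_eqF.
Qed.

(** * Lifting functions from vertices to oriented edges *)

Definition terminus_lift (f : {ffun V -> C^o}) : {ffun B -> C^o} :=
  [ffun e => f (terminus e)].

(** Each vertex x is the terminus of deg x oriented edges, which is its mass. *)
Lemma inner_terminus_lift f g :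
  inner (emeasure C adj) (terminus_lift f) (terminus_lift g)
    = inner (vmeasure C adj) f g.
Proof.
transitivity (\sum_(e : B) (f (val e).2 : C) * (g (val e).2)^*).
  by apply: eq_bigr => e _; rewrite !ffunE mul1r.
rewrite (sum_oedge (fun p => f p.2 * (g p.2)^*)) sum_adj_swap /=.
by apply: eq_bigr => x _; rewrite sum_adj_const mulrA.
Qed.

Lemma terminus_lift_l2o f :
  (terminus_lift f \in l2o (emeasure C adj)) = (f \in l2o (vmeasure C adj)).
Proof.
rewrite !mem_l2o -inner_terminus_lift; congr (inner _ _ _ == 0).
by apply/ffunP => e; rewrite !ffunE.
Qed.

(** All deg(o(e)) - 1 edges preceding e end at o(e), so S averages a constant. *)
Lemma nbS_terminus_lift f e : S (terminus_lift f) e = f (origin e).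
Proof.
rewrite nbSE; under eq_bigr => e' _ do rewrite ffunE.
rewrite (sum_follows_to (fun p => f p.2)) /= sum_adj_const.
by rewrite -{2}[f (origin e)]mul1r -mulrBl mulKf ?gt_eqF.
Qed.

Lemma nbS2_terminus_lift f e :
  S (S (terminus_lift f)) e
    = (deg (origin e) - 1)^-1
      * (deg (origin e) * P f (origin e) - f (terminus e)).
Proof.
rewrite nbSE; under eq_bigr => e' _ do rewrite nbS_terminus_lift.
by rewrite (sum_follows_to (fun p => f p.1)) /= markovPE mulVKf ?gt_eqF.
Qed.

Lemma markov_le_nbS2 f :
  inner (vmeasure C adj) (P f) (P f)
    <= inner (emeasure C adj) (S (S (terminus_lift f)))
         (S (S (terminus_lift f))).
Proof.
rewrite !inner_normE.
pose g x y : C := (deg x - 1)^-1 * (deg x * P f x - f y).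
have -> : \sum_e emeasure C adj e * `|S (S (terminus_lift f)) e| ^+ 2
        = \sum_x \sum_(y | adj x y) `|g x y| ^+ 2.
  rewrite -(sum_oedge (fun p => `|g p.1 p.2| ^+ 2)).
  by apply: eq_bigr => e _; rewrite mul1r nbS2_terminus_lift.
apply: ler_sum => x _; apply: normr_neighbour_mean_le.
(* Over the deg x neighbours y of x, the terms [deg x * P f x - f y] add up to (deg x - 1) times
   [deg x * P f x], so the mean of [g x] is [P f x]. *)
rewrite -mulr_sumr sumrB sum_adj_const.
have -> : \sum_(y | adj x y) f y = deg x * P f x.
  by rewrite markovPE mulVKf ?gt_eqF.
by rewrite -{2}[deg x * P f x]mul1r -mulrBl mulKf ?gt_eqF.
Qed.

Lemma nbS2_form f g :
  inner (emeasure C adj) ((S' \o S' \o S \o S)%VF f) g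
    = inner (emeasure C adj) (S (S f)) (S (S g)).
Proof. by rewrite !comp_lfunE !adjointPr. Qed.

End Graph.

(** * Comparison of the two spectra *)

Local Open Scope complex_scope.

Theorem mainTheorem3 (R : realType) (V : finType) (adj : rel V)
    (adj_sym : symmetric adj) (adj_irr : irreflexive adj)
    (adj_conn : connected_graph adj) (adj_nbip : ~ bipartite adj)
    (D : nat) (degD : forall x : V, (3 <= degree adj x <= D)%N) (c : R) :
  (forall l : R[i],
     spectrum_on
       (nbS_adj R[i] adj \o nbS_adj R[i] adj \o nbS R[i] adj \o nbS R[i] adj)%VF
       (l2o (emeasure R[i] adj)) l ->
     0 <= l <= (1 - c)%:C) ->
  forall l : R[i],
    spectrum_on (markovP R[i] adj \o markovP R[i] adj)%VF
      (l2o (vmeasure R[i] adj)) l ->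
    0 <= l <= (1 - D%:R ^- 2 * c)%:C.
Proof.
move=> specS l specP.
have deg_ge2 x : (2 <= degree adj x)%N by have /andP[/ltnW] := degD x.
have vm_gt0 x : 0 < vmeasure R[i] adj x.
  by rewrite ltr0n (leq_trans _ (deg_ge2 x)).
have l2oP f := @markov_l2o R[i] V adj adj_sym deg_ge2 f.
have [|f [f_l2o f0 Pf]] := spectrum_on_eigenvector _ _ _ _ specP.
  by move=> f fW; rewrite comp_lfunE !l2oP.
set P := markovP R[i] adj in Pf; set S := nbS R[i] adj in specS.
pose N := inner (vmeasure R[i] adj) f f.
have N_gt0 : 0 < N by exact: inner_gt0.
have normP : inner (vmeasure R[i] adj) (P f) (P f) = l * N.
  by rewrite -markov_symmetric // -innerZl -Pf comp_lfunE.
have l_ge0 : 0 <= l by rewrite -(pmulr_lge0 _ N_gt0) -normP inner_ge0.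
have l_le1 : l <= 1.
  by rewrite -(ler_pM2r N_gt0) mul1r -normP markov_contraction.
have l_le1c : l <= (1 - c)%:C.
  rewrite -(ler_pM2r N_gt0) -normP -[N](inner_terminus_lift adj_sym f f).
  apply: le_trans (markov_le_nbS2 adj_sym deg_ge2 f) _.
  (* The squared norm of S^2 F is the form of S*^2 S^2 at F. This operator is symmetric and fixes
     the constants, whence the eigenvalue 1 given for them. *)
  rewrite -nbS2_form; apply: (@l2o_form_le _ _ _ 1).
  - move=> g h; rewrite nbS2_form.
    rewrite -[RHS]inner_conj // nbS2_form inner_conj //.
  - by rewrite !comp_lfunE !nbS1 // !nbS_adj1 // scale1r.
  - exact: rpred1.
  - by rewrite complex_real.
  - move=> k g g_l2o g0 Tg; have /andP[] // : 0 <= k <= (1 - c)%:C.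
    exact/specS/eigenvector_spectrum_on/Tg.
  - by rewrite terminus_lift_l2o.
(* A nonzero [f] requires a vertex, whose degree forces D to be positive; this gives D^-2 <= 1
   below. *)
have [x _] : exists x : V, true.
  apply/existsP; apply: contraNT f0 => /existsPn noV; apply/eqP/ffunP => x.
  by have := noV x.
have D_gt0 : (0 < D)%N.
  by have /andP[d_ge3 /(leq_trans d_ge3)/ltnW/ltnW] := degD x.
rewrite l_ge0 andTb; have [c_ge0|/ltW c_le0] := leP 0 c.
  apply: le_trans l_le1c _; rewrite lecR lerD2l lerN2 ler_piMl //.
  by rewrite invf_le1 ?exprn_gt0 ?ltr0n // exprn_ege1 // ler1n.
apply: le_trans l_le1 _; rewrite lecR lerDl oppr_ge0.
by rewrite mulr_ge0_le0 // invr_ge0 exprn_ge0.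
Qed.
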